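(* Let $A$, $B$, $C$ be $m \times n$ matrices over $\{-1,0,1\}$ such that $A$ has an entry $0$ and $(A,B,C)$ is independent from $B$. Then ${\rm IST}(A,B,C)=\infty$ if and only if one of the following holds: (1) $A$ and $C$ are layered matrices; or (2) $C$ is the all-$(-1)$ matrix and $A$ has all entries in columns $2,\dots,n$ equal to $-1$, with first-column entries $a_1,\dots,a_m\in\{0,-1\}$; or (3) $C$ is the all-$(-1)$ matrix and $A$ has all entries in columns $1,\dots,n-1$ equal to $-1$, with last-column entries $a_1,\dots,a_m\in\{0,-1\}$.
   Context: For an $m\times n$ matrix $M=[m_{ij}]$ over $\{-1,0,1\}$, $G_o(M)$ is the directed graph on $\{1,\dots,n+m\}$ with edges $j\to i$ for all $1\le j<i\le n$, and for $1\le p\le m$, $1\le j\le n$: an edge $j\to n+p$ if $m_{pj}=1$, an edge $n+p\to j$ if $m_{pj}=-1$, no edge if $m_{pj}=0$; no edges among $n+1,\dots,n+m$. A directed graph is semi-transitive if it is acyclic and for every directed path $u_1\to\cdots\to u_t$, $t\ge2$, either there is no edge $u_1\to u_t$ or all edges $u_i\to u_j$ ($1\le i<j\le t$) exist. For $m\times n$ matrices $A,B,C$ over $\{-1,0,1\}$, the morphism $\varphi$ replaces each entry $0,1,-1$ by the block $A,B,C$ respectively; $M^k(A,B,C)=\varphi^k([0])$ and $G_o^k(A,B,C)=G_o(M^k(A,B,C))$. If $A$ has an entry $0$, ${\rm IST}(A,B,C)$ is the least $\ell\ge0$ with $G_o^\ell(A,B,C)$ not semi-transitive, or $\infty$ if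 none exists. A matrix is layered if all entries in each row are identical. The triple $(A,B,C)$ is independent from $B$ if neither $A$ nor $C$ contains an entry $1$.
   Formalization: The formal theorem adds the hypothesis that C is layered whenever A is the zero matrix; without it the claim fails, e.g. A = B = [0 0], C = [0 -1], where IST is infinite but (1), (2) and (3) all fail. *)

(* Defs.v *)
From HB Require Import structures.
From mathcomp Require Import all_boot all_order all_algebra boolp.

Set Implicit Arguments.
Unset Strict Implicit.
Unset Printing Implicit Defensive.

Import GRing.Theory.
Local Open Scope ring_scope.

(* Matrices over {-1,0,1} are integer matrices satisfying [ternary]. *)
Definition ternary (m n : nat) (M : 'M[int]_(m, n)) : Prop :=
  forall p j, M p j \in [:: -1; 0; 1].

Definition layered (m n : nat) (M : 'M[int]_(m, n)) : Prop :=
  forall p j k, M p j = M p k.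

(* (u :: s) is the path u_1 -> ... -> u_t, with u_t = last u s, and
   [pairwise e (u :: s)] says that e u_i u_j holds whenever i < j.  For t = 1
   the second clause holds trivially. *)
Definition semi_transitive (T : eqType) (e : rel T) : Prop :=
  (forall c : seq T, cycle e c -> c = [::]) /\
  (forall u s, path e u s ->
     ~~ e u (last u s) \/ pairwise e (u :: s)).

(* Vertices 1, ..., n + m are numbered from 0: vertex j of the n-clique is
   [lshift m j] (case [inl j]) and vertex n + p is [rshift n p] (case [inr p]). *)
Definition Go (m n : nat) (M : 'M[int]_(m, n)) : rel 'I_(n + m) :=
  fun u v =>
    match split u, split v with
    | inl j, inl i => (j < i)%N
    | inl j, inr p => M p j == 1
    | inr p, inl j => M p j == -1
    | inr _, inr _ => false
    end.

Section Morphism.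
Variables (m n : nat) (A B C : 'M[int]_(m, n)).

(* Only used at x \in {-1,0,1}. *)
Definition block (x : int) : 'M[int]_(m, n) :=
  if x == 0 then A else if x == 1 then B else C.

Definition phi (p q : nat) (M : 'M[int]_(p, q)) :
    'M[int]_(\sum_(i < p) m, \sum_(j < q) n) :=
  \mxblock_(i < p, j < q) block (M i j).

(* dim d k is d ^ k (lemma dimE), in the form produced by iterating [phi]. *)
Fixpoint dim (d k : nat) : nat :=
  if k is k'.+1 then (\sum_(i < dim d k') d)%N else 1%N.

Fixpoint Mk (k : nat) : 'M[int]_(dim m k, dim n k) :=
  if k is k'.+1 then phi (Mk k') else (0 : 'M[int]_(1, 1)).

Definition Gok (k : nat) : rel 'I_(dim n k + dim m k) := Go (Mk k).

Definition not_semi_transitive_at : pred nat :=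
  fun l => `[< ~ semi_transitive (@Gok l) >].

(* [None] stands for infinity. *)
Definition IST : option nat :=
  if pselect (exists l, not_semi_transitive_at l) is left ex
  then Some (ex_minn ex) else None.

Definition independent_from_B : Prop :=
  forall p j, A p j != 1 /\ C p j != 1.

End Morphism.

Arguments Gok {m n} A B C k _ _.

Lemma dimE d k : dim d k = (d ^ k)%N.
Proof. by elim: k => //= k ->; rewrite sum_nat_const card_ord expnSr. Qed.

Lemma phi_Rank m n (A B C : 'M[int]_(m, n)) p q (M : 'M[int]_(p, q))
    (i : 'I_p) (j : 'I_q) (r : 'I_m) (c : 'I_n) :
  phi A B C M (tagnat.Rank i r) (tagnat.Rank j c) = block A B C (M i j) r c.
Proof.
have := congr1 (fun X : 'M_(m, n) => X r c)
  (mxblockK (fun i j => block A B C (M i j)) i j).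
by rewrite /submxblock !mxE.
Qed.

Lemma IST_SomeP m n (A B C : 'M[int]_(m, n)) l :
  IST A B C = Some l <->
  ~ semi_transitive (Gok A B C l) /\
  (forall k, (k < l)%N -> semi_transitive (Gok A B C k)).
Proof.
rewrite /IST; case: pselect => [ex|nex]; last first.
  by split=> // -[nst _]; case: nex; exists l; apply/asboolP.
case: ex_minnP => k /asboolP nst kmin.
split=> [[<-]|[nstl stl]].
  split=> // j lt_jk; apply: contrapT => /asboolP/kmin.
  by rewrite leqNgt lt_jk.
congr Some; apply/eqP; rewrite eqn_leq kmin /=; last by apply/asboolP.
by rewrite leqNgt; apply/negP => /stl.
Qed.

Lemma IST_NoneP m n (A B C : 'M[int]_(m, n)) :
  IST A B C = None <-> forall k, semi_transitive (Gok A B C k).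
Proof.
rewrite /IST; case: pselect => [ex|nex].
  by split=> // st; have [l /asboolP nst] := ex; case: nst.
split=> // _ k; apply: contrapT => nst; apply: nex; exists k; exact/asboolP.
Qed.

(* Main.v *)
(* Since neither A nor C has an entry 1, neither has any iterate M^k, so in
   G_o(M^k) the vertices n + p are sources, and the graph is semi-transitive iff
   in every row of M^k the columns carrying -1 form an interval.  If a row of M^k
   carries the same entry x twice, then M^(k+1) has rows containing two copies of
   each row of the block of x, and a row with both entries 0 and -1 cannot occur
   twice: hence the block of x is layered.  So if A is not layered, every row of
   every M^k has at most one zero; this forces C to be all -1, and it forces the
   zeros of A into a single extreme column. *)
Require Import Defs.
From HB Require Import structures.
From mathcomp Require Import all_boot all_order all_algebra.
From mathcomp Require Import boolp.

Set Implicit Arguments.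
Unset Strict Implicit.
Unset Printing Implicit Defensive.

Import GRing.Theory.
Local Open Scope ring_scope.

(** * Matrices over {0,-1} and the shapes of their rows *)

Definition zero_neg m n (M : 'M[int]_(m, n)) : Prop :=
  forall p j, M p j \in [:: 0; -1].

Definition row_convex m n (M : 'M[int]_(m, n)) : Prop :=
  forall p (i j k : 'I_n), (i < j)%N -> (j < k)%N ->
    M p i = -1 -> M p k = -1 -> M p j = -1.

(** Comparing two columns, instead of naming column 0, lets the condition pass through [phi] by
    lexicographic comparison of block indices; [neg_afterE] recovers the column form. The same goes
    for [neg_before]. *)
Definition neg_after m n (M : 'M[int]_(m, n)) : Prop :=
  forall p (j k : 'I_n), (j < k)%N -> M p k = -1.

Definition neg_before m n (M : 'M[int]_(m, n)) : Prop :=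
  forall p (j k : 'I_n), (j < k)%N -> M p j = -1.

Lemma zero_negP m n (M : 'M[int]_(m, n)) p j :
  zero_neg M -> M p j = 0 \/ M p j = -1.
Proof. by move=> /(_ p j); rewrite !inE => /orP[] /eqP; [left|right]. Qed.

Lemma zero_neg_ternary m n (M : 'M[int]_(m, n)) :
  ternary M -> (forall p j, M p j != 1) -> zero_neg M.
Proof.
move=> tM M1 p j; have := tM p j.
by rewrite !inE (negPf (M1 p j)) orbF orbC.
Qed.

Lemma layered_convex m n (M : 'M[int]_(m, n)) : layered M -> row_convex M.
Proof. by move=> lM p i j k _ _ <- _; apply: lM. Qed.

Lemma neg_after_convex m n (M : 'M[int]_(m, n)) :
  neg_after M -> row_convex M.
Proof. by move=> nM p i j k lt_ij _ _ _; apply: nM lt_ij. Qed.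

Lemma neg_before_convex m n (M : 'M[int]_(m, n)) :
  neg_before M -> row_convex M.
Proof. by move=> nM p i j k _ lt_jk _ _; apply: nM lt_jk. Qed.

(** * Semi-transitivity of the graph as convexity of the rows *)

Section Graph.
Context {m n : nat} {M : 'M[int]_(m, n)}.

Lemma Go_ll j i : Go M (lshift m j) (lshift m i) = (j < i)%N.
Proof. by rewrite /Go (unsplitK (inl j)) (unsplitK (inl i)). Qed.

Lemma Go_rl p j : Go M (rshift n p) (lshift m j) = (M p j == -1).
Proof. by rewrite /Go (unsplitK (inr p)) (unsplitK (inl j)). Qed.

Hypothesis M01 : zero_neg M.

Lemma Go_lr j p : Go M (lshift m j) (rshift n p) = false.
Proof.
rewrite /Go (unsplitK (inl j)) (unsplitK (inr p)).
by case: (zero_negP p j M01) => ->.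
Qed.

Lemma Go_rr p q : Go M (rshift n p) (rshift n q) = false.
Proof. by rewrite /Go (unsplitK (inr p)) (unsplitK (inr q)). Qed.

Lemma vertexP {a b} (v : 'I_(a + b)) :
  (exists j, v = lshift b j) \/ (exists p, v = rshift a p).
Proof. by case: (split_ordP v) => [j ->|p ->]; [left; exists j|right; exists p]. Qed.

Lemma Go_target u v : Go M u v -> exists j, v = lshift m j.
Proof.
case: (vertexP v) => // -[q ->].
by case: (vertexP u) => -[x ->]; rewrite ?Go_lr ?Go_rr.
Qed.

(** Without entries 1 the vertices [rshift n p] are sources, so a path can only start at one and
    then climbs in the clique. *)
Lemma Go_path u s : path (Go M) u s ->
  exists2 t : seq 'I_n, s = map (lshift m) t & pairwise (relpre val ltn) t.
Proof.
have tr : transitive (relpre (@nat_of_ord n) ltn) by move=> y x z; apply: ltn_trans.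
elim: s u => [|v s IHs] u /=; first by exists [::].
case/andP=> /Go_target[j ->] js; have [t st _] := IHs _ js.
exists (j :: t); first by rewrite st.
rewrite -sorted_pairwise //=; move: js; rewrite st path_map.
by apply: sub_path => x y /=; rewrite Go_ll.
Qed.

Lemma Go_acyclic c : cycle (Go M) c -> c = [::].
Proof.
case: c => // v s cyc.
(* The height [h] is 0 on the sources and positive on the clique, hence strictly increases along
   every edge. *)
pose h (v : 'I_(n + m)) := if split v is inl j then (j : nat).+1 else 0%N.
have hE u w : Go M u w -> relpre h ltn u w.
  move=> euw; have [j wE] := Go_target euw; move: euw; rewrite wE.
  case: (vertexP u) => -[x ->]; rewrite /= /h (unsplitK (inl j)).
    by rewrite (unsplitK (inl x)) Go_ll.
  by rewrite (unsplitK (inr x)).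
have tr : transitive (relpre h ltn) by move=> y x z; apply: ltn_trans.
have /(order_path_min tr)/allP/(_ v) : path (relpre h ltn) v (rcons s v).
  by move: cyc; apply: sub_path.
by rewrite mem_rcons mem_head /= ltnn => /(_ isT).
Qed.

Lemma semi_transitive_GoP : semi_transitive (Go M) <-> row_convex M.
Proof.
split=> [[_ st] p i j k lt_ij lt_jk Mi Mk|cM].
  (* The edge from the source to [k] closes this path, so the edge to [j] is forced. *)
  have := st (rshift n p) [:: lshift m i; lshift m j; lshift m k].
  rewrite /= !Go_rl !Go_ll Mi Mk lt_ij lt_jk eqxx => /(_ isT)[]//.
  by rewrite !andbT => /andP[/eqP].
split=> [|u s us]; first exact: Go_acyclic.
have [t st tP] := Go_path us.
have pt : pairwise (Go M) s.
  rewrite st pairwise_map; apply: sub_pairwise tP => x y /=.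
  by rewrite Go_ll.
case: (boolP (Go M u (last u s))) => [e_last|]; [right | by left].
rewrite /= pt andbT; case: (vertexP u) => -[x uE].
  have xt : path (relpre val ltn) x t.
    move: us; rewrite uE st path_map.
    by apply: sub_path => y z /=; rewrite Go_ll.
  have tr : transitive (relpre (@nat_of_ord n) ltn).
    by move=> y1 y2 y3; apply: ltn_trans.
  rewrite uE st all_map; move: (order_path_min tr xt).
  by apply: sub_all => y /=; rewrite Go_ll.
(* The path starts at a source: its first and last clique vertices carry -1 in row [x], and
   convexity supplies the edges to all vertices in between. *)
rewrite {}uE {}st {pt} in us e_last *; rewrite all_map; apply/allP => z /=.
case/lastP: t => // t l in tP us e_last *.
move: e_last; rewrite map_rcons last_rcons !Go_rl => /eqP Ml.
rewrite mem_rcons inE => /predU1P[->|]; first by rewrite Ml.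
case: t => // j t in tP us *; move: us; rewrite /= Go_rl => /andP[/eqP Mj _].
move: tP; rewrite pairwise_rcons => /andP[/allP tl] /= /andP[/allP jt _] zt.
have lt_zl := tl _ zt; move: zt; rewrite inE => /predU1P[->|zt].
  by rewrite Mj.
by apply/eqP; apply: cM (jt _ zt) lt_zl Mj Ml.
Qed.

End Graph.

(** * Lexicographic order on block indices *)

Section Rank.
Context {p m : nat}.
Local Notation Rank := (@tagnat.Rank p (fun=> m)).

Lemma RankP (u : 'I_(\sum_(i < p) m)) : exists i r, u = Rank i r.
Proof. by exists (tagnat.sig1 u), (tagnat.sig2 u); rewrite tagnat.sig2K. Qed.

Lemma ltn_Rank_block (i j : 'I_p) (r c : 'I_m) :
  (i < j)%N -> (Rank i r < Rank j c)%N.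
Proof.
apply: contraTT; rewrite -!leqNgt => le_ji.
by have := tagnat.le_sig1 le_ji; rewrite !tagnat.Rank1K.
Qed.

Lemma ltn_Rank_in (i : 'I_p) (r c : 'I_m) :
  (r < c)%N -> (Rank i r < Rank i c)%N.
Proof.
by have := @tagnat.lt_Rank p (fun=> m) i r c; rewrite !ltEord => ->.
Qed.

Lemma ltn_RankP (i j : 'I_p) (r c : 'I_m) : (Rank i r < Rank j c)%N ->
  (i < j)%N \/ i = j /\ (r < c)%N.
Proof.
case: (ltngtP i j) => [|lt_ji|/val_inj->]; first by left.
  by rewrite ltnNge ltnW // ltn_Rank_block.
case: (ltngtP r c) => [|lt_cr|/val_inj->]; first by right.
  by rewrite ltnNge ltnW // ltn_Rank_in.
by rewrite ltnn.
Qed.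

End Rank.

(** * Row shapes under [phi] and its iterates *)

Section Iterates.
Context {m n : nat} {A B C : 'M[int]_(m, n)}.
Hypotheses (A01 : zero_neg A) (C01 : zero_neg C).

Lemma block0 : block A B C 0 = A. Proof. by []. Qed.
Lemma blockN1 : block A B C (-1) = C. Proof. by []. Qed.

Lemma zero_neg_block x : x \in [:: 0; -1] -> zero_neg (block A B C x).
Proof. by rewrite !inE => /orP[] /eqP->. Qed.

Section Phi.
Context {p q : nat} {M : 'M[int]_(p, q)}.
Hypothesis M01 : zero_neg M.

Lemma zero_neg_phi : zero_neg (phi A B C M).
Proof.
move=> u v; have [i [r ->]] := RankP u; have [j [c ->]] := RankP v.
by rewrite phi_Rank; apply: zero_neg_block.
Qed.

Lemma layered_phi :
  layered A -> layered C -> layered M -> layered (phi A B C M).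
Proof.
move=> lA lC lM u v w; have [i [r ->]] := RankP u.
have [j [c ->]] := RankP v; have [k [d ->]] := RankP w.
rewrite !phi_Rank (lM i j k).
by case: (zero_negP i k M01) => ->; [apply: lA | apply: lC].
Qed.

(** A later column lies either in a later block, which is a copy of [C], or later inside the same
    block, where both [A] and [C] have -1. *)
Lemma neg_after_phi : C = const_mx (-1) ->
  neg_after A -> neg_after M -> neg_after (phi A B C M).
Proof.
move=> Cneg nA nM u v w; have [i [r ->]] := RankP u.
have [j [c ->]] := RankP v; have [k [d ->]] := RankP w.
rewrite phi_Rank => /ltn_RankP[lt_jk|[_ lt_cd]].
  by rewrite (nM i j k) // blockN1 Cneg mxE.
case: (zero_negP i k M01) => ->; first exact: nA lt_cd.
by rewrite blockN1 Cneg mxE.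
Qed.

Lemma neg_before_phi : C = const_mx (-1) ->
  neg_before A -> neg_before M -> neg_before (phi A B C M).
Proof.
move=> Cneg nA nM u v w; have [i [r ->]] := RankP u.
have [j [c ->]] := RankP v; have [k [d ->]] := RankP w.
rewrite phi_Rank => /ltn_RankP[lt_jk|[_ lt_cd]].
  by rewrite (nM i j k) // blockN1 Cneg mxE.
case: (zero_negP i j M01) => ->; first exact: nA lt_cd.
by rewrite blockN1 Cneg mxE.
Qed.

(** Two copies of a row containing both 0 and -1 place some 0 between two entries -1, against
    convexity. *)
Lemma repeated_entry_layered i (j k : 'I_q) : row_convex (phi A B C M) ->
  (j < k)%N -> M i j = M i k -> layered (block A B C (M i j)).
Proof.
move=> cM lt_jk Mjk; set X := block _ _ _ _.
have jE r c : phi A B C M (tagnat.Rank i r) (tagnat.Rank j c) = X r c.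
  by rewrite phi_Rank.
have kE r c : phi A B C M (tagnat.Rank i r) (tagnat.Rank k c) = X r c.
  by rewrite phi_Rank -Mjk.
have X01 : zero_neg X := zero_neg_block (M01 i j).
have noX r c d : X r c = -1 -> X r d <> 0.
  (* If the 0 comes after the -1, the copy of the 0 in block [j] is enclosed; otherwise the copy in
     block [k] is. *)
  move=> Xc Xd; case: (ltngtP c d) => [lt_cd|lt_dc|/val_inj cd].
  - have := cM (tagnat.Rank i r) (tagnat.Rank j c) (tagnat.Rank j d)
      (tagnat.Rank k c) (ltn_Rank_in _ lt_cd) (ltn_Rank_block _ _ lt_jk).
    by rewrite !jE kE Xd => /(_ Xc Xc).
  - have := cM (tagnat.Rank i r) (tagnat.Rank j c) (tagnat.Rank k d)
      (tagnat.Rank k c) (ltn_Rank_block _ _ lt_jk) (ltn_Rank_in _ lt_dc).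
    by rewrite jE !kE Xd => /(_ Xc Xc).
  - by move: Xd; rewrite -cd Xc.
move=> r c d; case: (zero_negP r c X01) => Xc; case: (zero_negP r d X01) => Xd.
- by rewrite Xc Xd.
- by case: (noX _ _ _ Xd Xc).
- by case: (noX _ _ _ Xc Xd).
- by rewrite Xc Xd.
Qed.

End Phi.

Lemma zero_neg_Mk k : zero_neg (Mk A B C k).
Proof.
elim: k => [p j|k IHk]; first by rewrite mxE.
exact: zero_neg_phi.
Qed.

Lemma IST_None_convex :
  IST A B C = None <-> forall k, row_convex (Mk A B C k).
Proof.
rewrite IST_NoneP; split=> H k; have := H k;
  by rewrite /Gok semi_transitive_GoP //; apply: zero_neg_Mk.
Qed.

Lemma Mk1E r c :
  Mk A B C 1 (tagnat.Rank ord0 r) (tagnat.Rank ord0 c) = A r c.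
Proof. by rewrite /= phi_Rank mxE. Qed.

Lemma Mk2E i j r c :
  Mk A B C 2 (tagnat.Rank (tagnat.Rank ord0 i) r)
             (tagnat.Rank (tagnat.Rank ord0 j) c) = block A B C (A i j) r c.
Proof. by rewrite [Mk A B C 2]/= phi_Rank Mk1E. Qed.

Lemma layered_Mk k : layered A -> layered C -> layered (Mk A B C k).
Proof.
move=> lA lC; elim: k => [|k IHk]; first by move=> p i j; rewrite !mxE.
exact: layered_phi (@zero_neg_Mk k) lA lC IHk.
Qed.

Lemma neg_after_Mk k :
  C = const_mx (-1) -> neg_after A -> neg_after (Mk A B C k).
Proof.
(* The initial matrix has a single column, so the base case is vacuous. *)
move=> Cneg nA; elim: k => [p i j|k IHk]; first by rewrite !ord1.
exact: neg_after_phi (@zero_neg_Mk k) Cneg nA IHk.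
Qed.

Lemma neg_before_Mk k :
  C = const_mx (-1) -> neg_before A -> neg_before (Mk A B C k).
Proof.
move=> Cneg nA; elim: k => [p i j|k IHk]; first by rewrite !ord1.
exact: neg_before_phi (@zero_neg_Mk k) Cneg nA IHk.
Qed.

(** * Constraints on [A] and [C] when all iterates are convex *)

Hypothesis cvx : forall k, row_convex (Mk A B C k).

Lemma repeated_Mk k i u v : u != v -> Mk A B C k i u = Mk A B C k i v ->
  layered (block A B C (Mk A B C k i u)).
Proof.
move=> neq_uv Muv; case: (ltngtP u v) => [lt_uv|lt_vu|/val_inj].
- exact: (@repeated_entry_layered _ _ _ (@zero_neg_Mk k) _ _ _
            (@cvx k.+1) lt_uv Muv).
- rewrite Muv.
  exact: (@repeated_entry_layered _ _ _ (@zero_neg_Mk k) _ _ _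
           (@cvx k.+1) lt_vu (esym Muv)).
- by move/eqP; rewrite (negPf neq_uv).
Qed.

(** A layered [A] repeats its -1 across row [p] as soon as there are two columns, and the block of
    -1 is [C]; with one column there is nothing to compare. *)
Lemma layered_C : layered A -> (exists p j, A p j = -1) -> layered C.
Proof.
move=> lA [p [j Aj]] r c d.
have [->//|neq_cd] := eqVneq c d.
have := @repeated_Mk 1 (tagnat.Rank ord0 p) (tagnat.Rank ord0 c)
  (tagnat.Rank ord0 d).
rewrite !Mk1E (lA p c j) (lA p d j) Aj blockN1; apply=> //.
by rewrite -val_eqE /= tagnat.eq_Rank eqxx.
Qed.

Section NonLayered.
Hypothesis nlA : ~ layered A.

(** Two zeros in one row would make the block of 0, which is [A], layered. *)
Lemma zero_unique k i u v :
  Mk A B C k i u = 0 -> Mk A B C k i v = 0 -> u = v.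
Proof.
move=> Mu Mv; apply/eqP/negPn/negP => neq_uv; apply: nlA.
by have := repeated_Mk neq_uv (etrans Mu (esym Mv)); rewrite Mu.
Qed.

Lemma A_zero_unique p j k : A p j = 0 -> A p k = 0 -> j = k.
Proof.
rewrite -(Mk1E p j) -(Mk1E p k) => Aj Ak.
have /eqP := zero_unique Aj Ak.
by rewrite -val_eqE /= tagnat.eq_Rank eqxx => /eqP/val_inj.
Qed.

Lemma nonlayered_row : exists p j k, A p j = 0 /\ A p k = -1.
Proof.
apply: contrapT => no; apply: nlA => p j k.
case: (zero_negP p j A01) => Aj; case: (zero_negP p k A01) => Ak.
- by rewrite Aj Ak.
- by case: no; exists p, j, k.
- by case: no; exists p, k, j.
- by rewrite Aj Ak.
Qed.

Lemma C_all_neg : C = const_mx (-1).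
Proof.
(* The zero at (j, j) in row (p, p) of M^2 is the only one, so that row has at
   least two entries -1, and a zero of C would appear twice in a row of M^3. *)
have [p [j [k [Aj Ak]]]] := nonlayered_row.
have neq_jk : j != k by apply/eqP => jk; move: Aj; rewrite jk Ak.
pose R (i : 'I_m) (r : 'I_m) := tagnat.Rank (tagnat.Rank (ord0 : 'I_1) i) r.
pose S (i : 'I_n) (r : 'I_n) := tagnat.Rank (tagnat.Rank (ord0 : 'I_1) i) r.
have neqS i r i' r' : (i, r) != (i', r') -> S i r != S i' r'.
  apply: contra => /eqP /(congr1 val) /eqP.
  rewrite /= tagnat.eq_Rank -val_eqE /= tagnat.eq_Rank eqxx /=.
  by case/andP=> /eqP/val_inj-> /eqP/val_inj->.
have M0 : Mk A B C 2 (R p p) (S j j) = 0 by rewrite Mk2E Aj.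
have MN u : S j j != u -> Mk A B C 2 (R p p) u = -1.
  move=> neq; case: (zero_negP (R p p) u (@zero_neg_Mk 2)) => // Mu.
  by move: neq; rewrite (zero_unique M0 Mu) eqxx.
apply/matrixP => r c; rewrite mxE.
case: (zero_negP r c C01) => // Cc.
have M3 u : S j j != u ->
    Mk A B C 3 (tagnat.Rank (R p p) r) (tagnat.Rank u c) = 0.
  by move=> neq; rewrite [Mk A B C 3]/= phi_Rank (MN _ neq).
(* Since [j] and [k] differ, [S k j] and [S k k] are two distinct columns, both other than the
   column [S j j] of the zero. *)
have /eqP : tagnat.Rank (S k j) c = tagnat.Rank (S k k) c.
  by apply: (@zero_unique 3 (tagnat.Rank (R p p) r)); apply: M3; apply: neqS;
    rewrite xpair_eqE (negPf neq_jk).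
rewrite -val_eqE /= tagnat.eq_Rank => /andP[/eqP SE _].
have : S k j != S k k by apply: neqS; rewrite xpair_eqE (negPf neq_jk) andbF.
by rewrite SE eqxx.
Qed.

(** In row (p,q) of the second iterate, block [j] is row [q] of [A] and block [k] is all -1. If
    [j < k], a zero of row [q] outside the first column would have -1 before it in its own block and
    -1 after it in block [k]. The case [k < j] is the mirror image. *)
Lemma neg_after_or_before : neg_after A \/ neg_before A.
Proof.
have [p [j [k [Aj Ak]]]] := nonlayered_row.
have AN q x y : x != y -> A q x = 0 -> A q y = -1.
  move=> neq Ax; case: (zero_negP q y A01) => // Ay.
  by move: neq; rewrite (A_zero_unique Ax Ay) eqxx.
case: (ltngtP j k) => [lt_jk|lt_kj|/val_inj jk]; last by rewrite jk Ak in Aj.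
  left=> q x y lt_xy; case: (zero_negP q y A01) => // Ay.
  have neq_yx : y != x by rewrite -val_eqE gtn_eqF.
  have := @cvx 2 (tagnat.Rank (tagnat.Rank ord0 p) q)
    (tagnat.Rank (tagnat.Rank ord0 j) x) (tagnat.Rank (tagnat.Rank ord0 j) y)
    (tagnat.Rank (tagnat.Rank ord0 k) y).
  rewrite !Mk2E Aj Ak block0 blockN1 Ay (AN _ _ _ neq_yx Ay) C_all_neg mxE.
  by apply=> //; [apply: ltn_Rank_in | apply/ltn_Rank_block/ltn_Rank_in].
right=> q x y lt_xy; case: (zero_negP q x A01) => // Ax.
have neq_xy : x != y by rewrite -val_eqE ltn_eqF.
have := @cvx 2 (tagnat.Rank (tagnat.Rank ord0 p) q)
  (tagnat.Rank (tagnat.Rank ord0 k) x) (tagnat.Rank (tagnat.Rank ord0 j) x)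
  (tagnat.Rank (tagnat.Rank ord0 j) y).
rewrite !Mk2E Aj Ak block0 blockN1 Ax (AN _ _ _ neq_xy Ax) C_all_neg mxE.
by apply=> //; [apply/ltn_Rank_block/ltn_Rank_in | apply: ltn_Rank_in].
Qed.

End NonLayered.

End Iterates.

(** * Column form of the two extreme shapes, and the equivalence *)

Lemma neg_afterE m n (A : 'M[int]_(m, n)) :
  neg_after A <-> forall p (j : 'I_n), (0 < j)%N -> A p j = -1.
Proof.
split=> [nA p j j_gt0|nA p j k lt_jk].
  exact: (nA p (Ordinal (ltn_trans j_gt0 (ltn_ord j)))).
exact/nA/(leq_ltn_trans (leq0n j)).
Qed.

Lemma neg_beforeE m n (A : 'M[int]_(m, n)) :
  neg_before A <-> forall p (j : 'I_n), (j < n.-1)%N -> A p j = -1.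
Proof.
split=> [nA p j lt_jn|nA p j k lt_jk].
  have lt_j1n : (j.+1 < n)%N by move: lt_jn; rewrite -ltnS; case: n j {A nA}.
  exact: (nA p j (Ordinal lt_j1n)).
apply: nA; apply: leq_trans lt_jk _.
by rewrite -ltnS (leq_trans (ltn_ord k)) // leqSpred.
Qed.

(* The hypothesis hA0C is not in the printed statement, which fails without it:
   if A = 0 then every M^k(A,B,C) is the zero matrix and IST(A,B,C) is infinite
   for every C, whereas (1)-(3) all fail if n >= 2 and C is not layered. *)
Theorem theorem3p13 (m n : nat) (A B C : 'M[int]_(m, n))
    (hA : ternary A) (hB : ternary B) (hC : ternary C)
    (hA0 : exists p j, A p j = 0)
    (hind : independent_from_B A C)
    (hA0C : A = 0 -> layered C) :
  IST A B C = None <->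
  [\/ layered A /\ layered C,
      [/\ C = const_mx (-1),
          forall (p : 'I_m) (j : 'I_n), (0 < j)%N -> A p j = -1
        & forall (p : 'I_m) (j : 'I_n), j = 0%N :> nat -> A p j \in [:: 0; -1]]
    | [/\ C = const_mx (-1),
          forall (p : 'I_m) (j : 'I_n), (j < n.-1)%N -> A p j = -1
        & forall (p : 'I_m) (j : 'I_n),
            j = n.-1 :> nat -> A p j \in [:: 0; -1]]].
Proof.
have A01 : zero_neg A by apply: zero_neg_ternary => // p j; case: (hind p j).
have C01 : zero_neg C by apply: zero_neg_ternary => // p j; case: (hind p j).
rewrite IST_None_convex //; split=> [cvx|]; last first.
  case=> [[lA lC]|[Cneg /neg_afterE nA _]|[Cneg /neg_beforeE nA _]] k.
  - exact/layered_convex/layered_Mk.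
  - exact/neg_after_convex/neg_after_Mk.
  - exact/neg_before_convex/neg_before_Mk.
have [lA|nlA] := pselect (layered A).
  apply: Or31; split=> //.
  have [ex|no] := pselect (exists p j, A p j = -1); first exact: layered_C ex.
  (* With no entry -1 left, [A] is the zero matrix. *)
  apply: hA0C; apply/matrixP => p j; rewrite mxE.
  by case: (zero_negP p j A01) => // Aj; case: no; exists p, j.
have Cneg := C_all_neg A01 C01 cvx nlA.
have [/neg_afterE nA|/neg_beforeE nA] := neg_after_or_before A01 C01 cvx nlA.
  by apply: Or32; split=> // p j _; apply: A01.
by apply: Or33; split=> // p j _; apply: A01.
Qed.
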